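(* For a group $G$, the following are equivalent: (1) $G$ admits a finite-dimensional model for $\mathrm{E}_{\mathfrak P}G$; (2) every finite subgroup of $G$ is in $\mathfrak P$ and $G$ admits a finite-dimensional model for $\underline{\mathrm{E}}G=\mathrm{E}_{\mathfrak F}G$.
   Context: $\mathfrak F$ denotes the class of all finite groups and $\mathfrak P$ denotes the class of finite groups of prime power order (groups of order $p^a$ for some prime $p$ and some integer $a\ge 0$; the trivial group is included). A class of groups means a collection of groups closed under isomorphism and under taking subgroups. For a class of groups $\mathcal F$ and a (discrete) group $G$, a $G$-CW-complex $X$ is said to be a model for $\mathrm{E}_{\mathcal F}G$ if, for every subgroup $H\le G$, the fixed point set $X^H$ is contractible when $H\in\mathcal F$ and is empty when $H\notin\mathcal F$. In a $G$-CW-complex the setwise stabilizer of each cell fixes the cell pointwise. *)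

(* Defs.v *)
From HB Require Import structures.
From mathcomp Require Import all_boot all_order all_algebra all_fingroup.
From mathcomp Require Import all_classical all_reals all_analysis.

Set Implicit Arguments.
Unset Strict Implicit.
Unset Printing Implicit Defensive.

Import Order.TTheory GRing.Theory Num.Theory.
Import numFieldNormedType.Exports.

Local Open Scope classical_set_scope.
Local Open Scope card_scope.
Local Open Scope ring_scope.

(* A subgroup of a (possibly infinite) group G is a predicate H : groupClosed G;
   membership is boolean, which is no restriction since classical logic is
   available. [subgroup H] is H regarded as a group in its own right. *)
Section Subgroup.
Variables (G : groupType) (H : groupClosed G).

Definition subgroup := {x : G | x \in H}.

HB.instance Definition _ := SubChoice.on subgroup.

Lemma subgroup_closed : group_closed (fun x : G => x \in H).
Proof.
split; first exact: gpred1.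
by move=> x y Hx Hy; apply: gpredM => //; rewrite gpredV.
Qed.

HB.instance Definition _ :=
  SubChoice_isSubGroup.Build G (fun x : G => x \in H) subgroup subgroup_closed.

End Subgroup.

Definition group_isomorphic (G K : groupType) : Prop :=
  exists f : G -> K, {morph f : x y / (x * y)%g} /\ bijective f.

Record group_class := GroupClass {
  in_class :> groupType -> Prop;
  in_class_iso : forall G K : groupType,
    group_isomorphic G K -> in_class G -> in_class K;
  in_class_sub : forall (G : groupType) (H : groupClosed G),
    in_class G -> in_class (subgroup H) }.

Definition finite_group (G : groupType) : Prop := finite_set [set: G].

Definition prime_power_group (G : groupType) : Prop :=
  exists p a : nat, prime p /\ [set: G] #= `I_(p ^ a).

Lemma card_uniq_seq (T : eqType) (e : seq T) :
  uniq e -> [set` e] #= `I_(size e).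
Proof.
move=> e_uniq; rewrite card_eq_sym.
suff <- : (index^~ e) @` [set` e] = `I_(size e).
  apply: inj_card_eq => x y /set_mem/= xe /set_mem/= ye.
  exact: index_inj.
rewrite predeqE => i; split=> [[x /= xe <-]|/= ie]; first by rewrite index_mem.
case: e e_uniq ie => // x0 e e_uniq ie.
by exists (nth x0 (x0 :: e) i); [exact: mem_nth|exact: index_uniq].
Qed.

Lemma group_isomorphic_card (G K : groupType) :
  group_isomorphic G K -> [set: K] #= [set: G].
Proof.
move=> [f [_ [g fK gK]]]; rewrite -(_ : f @` [set: G] = [set: K]).
  by apply: inj_card_eq => x y _ _; exact: (can_inj fK).
by rewrite predeqE => y; split=> // _; exists (g y).
Qed.

(* Lagrange's theorem, obtained from that of finGroupType. *)
Lemma Lagrange_subgroup (G : groupType) (H : groupClosed G) (n : nat) :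
  [set: G] #= `I_n -> exists2 m, (m %| n)%N & [set: subgroup H] #= `I_m.
Proof.
move=> Gn; have [e eE] : exists e : seq G, [set: G] = [set` e].
  by apply/finite_seqP; exists n.
have e_mem x : x \in undup e.
  by rewrite mem_undup; have : [set: G] x by []; rewrite eE.
have e_enum : Finite.axiom (undup e).
  by move=> x; rewrite count_uniq_mem ?undup_uniq// e_mem.
have e_pcan : pcancel (index^~ (undup e)) (onth (undup e)).
  by move=> x; rewrite onthE (nth_map x) ?index_mem// nth_index.
pose gT : finGroupType := HB.pack_for finGroupType G
  (Choice_isCountable.Build G e_pcan) (fintype.isFinite.Build G e_enum).
pose A : {set gT} := [set x : gT | (x : G) \in H]%SET.
have A_group : group_set A.
  apply/group_setP; split=> [|x y]; rewrite !inE; first exact: gpred1.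
  exact: gpredM.
have := cardSg (finset.subsetT (Group A_group)).
have cardG (B : {set gT}) : [set` enum B] #= `I_#|B|.
  by rewrite cardE; exact/card_uniq_seq/enum_uniq.
have <- : n = #|[set: gT]%SET|.
  apply/card_eq_II; rewrite card_eq_sym; apply: card_eq_trans Gn.
  rewrite card_eq_sym -(_ : [set` enum [set: gT]%SET] = [set: G]) ?cardG//.
  rewrite predeqE => x; split=> // _.
  by have : (x : gT) \in enum [set: gT]%SET by rewrite mem_enum inE.
move=> An; exists #|A| => //.
apply: card_eq_trans (cardG A).
rewrite -(_ : (val : subgroup H -> G) @` [set: subgroup H] = [set` enum A]).
  by rewrite card_eq_sym; apply: inj_card_eq => x y _ _; exact: val_inj.
have enumA (x : gT) : (x \in enum A) = ((x : G) \in H).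
  by rewrite mem_enum inE.
rewrite predeqE => x; split=> [[[y yH] _ <-]|].
  by have : (y : gT) \in enum A by rewrite enumA.
by move=> xA; have xH : x \in H by [rewrite -enumA]; exists (exist _ x xH).
Qed.

Lemma finite_group_iso (G K : groupType) :
  group_isomorphic G K -> finite_group G -> finite_group K.
Proof. by move=> /group_isomorphic_card/card_eq_trans h [n /h]; exists n. Qed.

Lemma finite_group_sub (G : groupType) (H : groupClosed G) :
  finite_group G -> finite_group (subgroup H).
Proof. by move=> [n /(@Lagrange_subgroup _ H)[m _]]; exists m. Qed.

Lemma prime_power_group_iso (G K : groupType) :
  group_isomorphic G K -> prime_power_group G -> prime_power_group K.
Proof.
by move=> /group_isomorphic_card/card_eq_trans h [p [a [p_pr /h]]]; exists p, a.
Qed.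

Lemma prime_power_group_sub (G : groupType) (H : groupClosed G) :
  prime_power_group G -> prime_power_group (subgroup H).
Proof.
move=> [p [a [p_pr /(@Lagrange_subgroup _ H)[m m_dvd Hm]]]].
by have [b _ m_pb] := (dvdn_pfactor m a p_pr m_dvd); exists p, b; rewrite -m_pb.
Qed.

Definition finite_groups : group_class :=
  GroupClass finite_group_iso finite_group_sub.

Definition prime_power_groups : group_class :=
  GroupClass prime_power_group_iso prime_power_group_sub.

(* The Euclidean disc, spelled out because the norm of 'rV[R]_n is the sup norm
   (the topology of 'rV[R]_n is the usual one). For n = 0 these are a point,
   a point and the empty set. *)
Definition disc (R : realType) (n : nat) : set 'rV[R]_n :=
  [set v | \sum_(i < n) v ord0 i ^+ 2 <= 1].

Definition open_disc (R : realType) (n : nat) : set 'rV[R]_n :=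
  [set v | \sum_(i < n) v ord0 i ^+ 2 < 1].

Definition sphere (R : realType) (n : nat) : set 'rV[R]_n :=
  [set v | \sum_(i < n) v ord0 i ^+ 2 = 1].

Arguments disc {R} n _.
Arguments open_disc {R} n _.
Arguments sphere {R} n _.

(* Whitehead's definition of a CW structure on X, by characteristic maps. Only
   the values of [char_map c] on the closed disc are meaningful. *)
Record cw_structure (R : realType) (X : topologicalType) := CWStructure {
  cell : Type;
  dim : cell -> nat;
  char_map : forall c : cell, 'rV[R]_(dim c) -> X;
  open_cell := fun c : cell => @char_map c @` open_disc (dim c);
  closed_cell := fun c : cell => @char_map c @` disc (dim c);
  cw_hausdorff : hausdorff_space X;
  char_map_continuous : forall c, {within disc (dim c), continuous @char_map c};
  char_map_inj : forall c, {in open_disc (dim c) &, injective (@char_map c)};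
  open_cell_disjoint : trivIset [set: cell] open_cell;
  open_cell_cover : \bigcup_(c in [set: cell]) open_cell c = [set: X];
  closure_finite : forall c, exists D : set cell,
    [/\ finite_set D,
        (forall d, D d -> (dim d < dim c)%N) &
        @char_map c @` sphere (dim c) `<=` \bigcup_(d in D) open_cell d];
  weak_topology : forall A : set X,
    (forall c, closed (A `&` closed_cell c)) -> closed A }.

(* G acts cellularly, and an element that maps an open cell onto itself fixes it
   pointwise; for discrete G this is equivalent to attaching cells G/K * D^n. *)
Record G_CW_complex (R : realType) (G : groupType) := GCWComplex {
  space :> topologicalType;
  cells : cw_structure R space;
  act : G -> space -> space;
  act1 : forall x, act 1%g x = x;
  actM : forall g h x, act (g * h)%g x = act g (act h x);
  act_continuous : forall g, continuous (act g);
  act_cell : forall g (c : cell cells), exists2 d : cell cells,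
    dim d = dim c & act g @` open_cell c = open_cell d;
  act_stab : forall g (c : cell cells),
    act g @` open_cell c = open_cell c -> forall x, open_cell c x -> act g x = x }.

Definition finite_dimensional (R : realType) (G : groupType)
    (X : G_CW_complex R G) : Prop :=
  exists N : nat, forall c : cell (cells X), (dim c <= N)%N.

Definition fixed_points (R : realType) (G : groupType) (X : G_CW_complex R G)
    (H : groupClosed G) : set X :=
  [set x | forall g, g \in H -> act g x = x].

Arguments fixed_points {R G} X H _.

Definition contractible (R : realType) (T : topologicalType) : Prop :=
  exists (x0 : T) (h : T * R -> T),
    [/\ {within [set: T] `*` `[0, 1]%classic, continuous h},
        (forall x, h (x, 0) = x) & (forall x, h (x, 1) = x0)].

(* [fixed_points X H], coerced to a type, carries the subspace topology. *)
Definition is_model_E (R : realType) (F : group_class) (G : groupType)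
    (X : G_CW_complex R G) : Prop :=
  forall H : groupClosed G,
    (F (subgroup H) -> contractible R (fixed_points X H)) /\
    (~ F (subgroup H) -> fixed_points X H = set0).

Definition admits_fd_model_E (R : realType) (F : group_class)
    (G : groupType) : Prop :=
  exists X : G_CW_complex R G, is_model_E F X /\ finite_dimensional X.

(* Main.v *)
Require Import Defs.
From HB Require Import structures.
From mathcomp Require Import all_boot all_order all_algebra all_fingroup.
From mathcomp Require Import all_classical all_reals all_analysis.
From mathcomp Require Import cyclic pgroup nilpotent sylow frobenius ring.

(** If every finite subgroup has prime power order, the two kinds of models
    are the same complexes, so the content is that a finite-dimensional model
    X for the family of prime power groups forces every finite subgroup H of G
    into that family.

    Suppose H is finite, but not of prime power order. A counting argument on
    Sylow subgroups ([not_prime_power_normalizer]) gives distinct primes p and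
    q, a nontrivial p-subgroup N of H and an element g of order q normalizing
    N. Then Y = X^N is contractible and g acts on it with g^q = 1. A point of Y
    fixed by a power g^i with q not dividing i would have a stabilizer that
    contains elements of order p and of order q; but stabilizers have prime
    power order, since X^S is empty for every other subgroup S. So g permutes
    freely the cells that meet Y, and it remains to prove that a finite cyclic
    group cannot act freely on a contractible space with a finite-dimensional
    cell-like filtration ([wandering_not_contractible]).

    Homologically this says that Z/q has infinite cohomological dimension. The
    proof below replaces cellular and singular chains by formal sums of finite
    sequences of points. On such chains, contractibility yields, for each m, a
    tower of chains c_0, .., c_m in which c_0 is a point and the boundary of
    c_(k+1) is (T - 1) c_k or (1 + T + .. + T^(q-1)) c_k according to the
    parity of k ([contraction_tower]); these are the images of the cells of the
    standard resolution of Z/q. The homotopy is cut in small steps, so that the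
    sequences in these chains are as small as any given open cover requires.
    In the other direction the n-dimensional filtration, thickened inside a
    compact set, produces closed sets B_0, .., B_n, each disjoint from its
    translates by T^i for q not dividing i, whose translates together cover
    all the points in use ([compact_wandering_cover]). If every sequence of a
    tower meets at most one translate of B, then the tower can be pushed off
    the translates of B at the cost of one level ([slice_tower]). After n + 1
    such steps the remaining c_0 lives on the empty sequence only, although it
    still has augmentation 1. *)

Set Implicit Arguments.
Unset Strict Implicit.
Unset Printing Implicit Defensive.

Import Order.TTheory GRing.Theory Num.Theory.
Import numFieldNormedType.Exports.

Local Open Scope classical_set_scope.
Local Open Scope card_scope.

(** * Cochains on finite sequences *)

Section Cochains.
Variables (Y : eqType) (F : comNzRingType).
Local Open Scope ring_scope.
Implicit Types (f g : seq Y -> F) (s t : seq Y).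

(** The alternating sum of the values of [f] at the faces of [s], by recursion
    on [s]. The empty sequence is a simplex of dimension -1, so on sequences of
    length one this is the dual of the augmentation. *)
Fixpoint coboundary f s : F :=
  if s is x :: s' then f s' - coboundary (fun t => f (x :: t)) s' else 0.

Lemma coboundary_local f g s :
  (forall t, {subset t <= s} -> f t = g t) -> coboundary f s = coboundary g s.
Proof.
elim: s f g => [//|x s IHs] f g fg /=; congr (_ - _).
  by apply: fg => y ys; rewrite inE ys orbT.
apply: IHs => t ts; apply: fg => y; rewrite !inE => /orP[->//|/ts->].
by rewrite orbT.
Qed.

Lemma coboundary0 s : coboundary (fun=> 0) s = 0.
Proof. by elim: s => //= x s ->; rewrite subr0. Qed.

Lemma coboundaryB f g s :
  coboundary (fun t => f t - g t) s = coboundary f s - coboundary g s.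
Proof.
elim: s f g => [|x s IHs] f g /=; first by rewrite subr0.
by rewrite IHs; ring.
Qed.

Lemma coboundaryN f s : coboundary (fun t => - f t) s = - coboundary f s.
Proof.
have := coboundaryB (fun=> 0) f s; rewrite coboundary0 sub0r => <-.
by congr coboundary; apply/funext => t; rewrite sub0r.
Qed.

Lemma coboundaryD f g s :
  coboundary (fun t => f t + g t) s = coboundary f s + coboundary g s.
Proof.
rewrite -[coboundary g s]opprK -coboundaryN -coboundaryB.
by congr coboundary; apply/funext => t; rewrite opprK.
Qed.

Lemma coboundary_sum n (f : nat -> seq Y -> F) s :
  coboundary (fun t => \sum_(i < n) f i t) s = \sum_(i < n) coboundary (f i) s.
Proof.
elim: n => [|n IHn].
  rewrite big_ord0 -[RHS](coboundary0 s).
  by congr coboundary; apply/funext => t; rewrite big_ord0.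
rewrite big_ord_recr /= -IHn -coboundaryD.
by congr coboundary; apply/funext => t; rewrite big_ord_recr.
Qed.

Lemma coboundary_map (a : Y -> Y) f s :
  coboundary (fun t => f (map a t)) s = coboundary f (map a s).
Proof.
elim: s f => //= x s IHs f.
by rewrite (IHs (fun t => f (a x :: t))).
Qed.

Lemma coboundaryK f s : coboundary (coboundary f) s = 0.
Proof. by elim: s f => //= x s IHs f; rewrite coboundaryB IHs subr0 subrr. Qed.

(** The prism between the images of a simplex under [a] and under [b], cut in
    the usual way into simplices that follow [a] up to some vertex, repeat this
    vertex under [b], and continue with [b]. *)
Fixpoint prism (a b : Y -> Y) f s : F :=
  if s is x :: s' then
    f [:: a x, b x & map b s'] - prism a b (fun t => f (a x :: t)) s'
  else 0.

Lemma prism_local a b f g s :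
  (forall t, {subset t <= map a s ++ map b s} -> f t = g t) ->
  prism a b f s = prism a b g s.
Proof.
elim: s f g => [//|x s IHs] f g fg /=; congr (_ - _).
  apply: fg => y; rewrite /= !(inE, mem_cat) => /or3P[->|->|->]//;
  by rewrite !orbT.
apply: IHs => t ts; apply: fg => y; rewrite /= !(inE, mem_cat).
by move=> /orP[->//|/ts]; rewrite mem_cat => /orP[->|->]; rewrite !orbT.
Qed.

Lemma prismB a b f g s :
  prism a b (fun t => f t - g t) s = prism a b f s - prism a b g s.
Proof.
elim: s f g => [|x s IHs] f g /=; first by rewrite subr0.
by rewrite IHs; ring.
Qed.

Lemma prism_homotopy a b f s :
  coboundary (prism a b f) s + prism a b (coboundary f) s =
  f (map b s) - f (map a s).
Proof.
elim: s f => [|x s IHs] f /=; first by rewrite addr0 subrr.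
rewrite coboundaryB prismB.
have := IHs (fun t => f (a x :: t)).
rewrite (coboundary_map b (fun t => f [:: a x, b x & t])).
set u := coboundary _ _; set v := prism _ _ _ _; set w := coboundary _ _.
set z := prism _ _ _ _ => e.
by rewrite [LHS](_ : _ = f (b x :: map b s) - f (a x :: map b s) + (u + v));
  [rewrite e; ring|ring].
Qed.

(** * Towers of chains for a cyclic action *)

Variables (T : Y -> Y) (q : nat).
Hypothesis q_gt0 : (0 < q)%N.
Hypothesis qF : q%:R = 0 :> F.
Hypothesis Tq : forall y, iter q T y = y.

Definition translate i s := map (iter i T) s.

Lemma translate0 s : translate 0 s = s.
Proof. by rewrite /translate map_id_in. Qed.

Lemma translateD i j s : translate (i + j) s = translate i (translate j s).
Proof. by rewrite /translate -map_comp; apply: eq_map => y; rewrite /= iterD. Qed.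

Lemma translate_q s : translate q s = s.
Proof. by rewrite /translate map_id_in // => y _; rewrite Tq. Qed.

Lemma translate_mod i s : translate (i %% q) s = translate i s.
Proof.
rewrite [in RHS](divn_eq i q) addnC translateD; congr translate.
elim: (i %/ q)%N => [|k IHk]; first by rewrite mul0n translate0.
by rewrite mulSn translateD -IHk translate_q.
Qed.

(** [diffT] and [normT] are the duals of T - 1 and 1 + T + .. + T^(q-1), the two
    alternating differentials of the standard resolution of Z/q. *)
Definition diffT f s := f (translate 1 s) - f s.
Definition normT f s := \sum_(i < q) f (translate i s).
Definition periodic k f := if odd k then normT f else diffT f.

Lemma normT_shift f s :
  \sum_(i < q) f (translate i.+1 s) = normT f s.
Proof.
rewrite /normT; case: q q_gt0 translate_q => // r _ tq.
by rewrite big_ord_recr big_ord_recl /= tq translate0 addrC.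
Qed.

Lemma normT_translate1 f s : normT f (translate 1 s) = normT f s.
Proof.
rewrite -[RHS]normT_shift; apply: eq_bigr => i _.
by rewrite -translateD addn1.
Qed.

Lemma periodicB k f g s :
  periodic k (fun t => f t - g t) s = periodic k f s - periodic k g s.
Proof.
rewrite /periodic /normT /diffT; case: (odd k); last by ring.
by rewrite sumrB.
Qed.

Lemma periodicK k f : periodic k (periodic k.+1 f) = fun=> 0.
Proof.
apply/funext => s; rewrite /periodic /=; case: (odd k) => /=; last first.
  by rewrite /diffT normT_translate1 subrr.
rewrite /normT sumrB.
under eq_bigr do rewrite -translateD add1n.
by rewrite normT_shift subrr.
Qed.

Lemma periodicS2 k f : periodic k.+2 f = periodic k f.
Proof. by rewrite /periodic /= negbK. Qed.

Lemma periodic_coboundary k f :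
  periodic k (coboundary f) = coboundary (periodic k f).
Proof.
apply/funext => s; rewrite /periodic; case: (odd k).
  rewrite /normT (coboundary_sum q (fun i t => f (translate i t))).
  by apply: eq_bigr => i _; rewrite coboundary_map.
by rewrite /diffT coboundaryB coboundary_map.
Qed.

(** On invariant cochains the norm is multiplication by [q], which vanishes in
    [F]. *)
Lemma periodic_invariant k f :
  (forall s, f (translate 1 s) = f s) -> periodic k f = fun=> 0.
Proof.
move=> fT; have fTi i s : f (translate i s) = f s.
  by elim: i => [|i IHi]; rewrite ?translate0// -[i.+1]add1n translateD fT.
apply/funext => s; rewrite /periodic; case: (odd k); last first.
  by rewrite /diffT fT subrr.
rewrite /normT (eq_bigr (fun=> f s)) => [|i _]; last exact: fTi.
by rewrite sumr_const card_ord -mulr_natr qF mulr0.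
Qed.

(** A chain is encoded as the linear functional that it defines on cochains, so
    that no free module is needed; it is supported on [S] when it only sees the
    values on [S]. *)
Definition is_chain (S : seq Y -> Prop) (c : (seq Y -> F) -> F) : Prop :=
  (forall f g, c (fun s => f s - g s) = c f - c g) /\
  (forall f g, (forall s, S s -> f s = g s) -> c f = c g).

Lemma chain0 S c : is_chain S c -> c (fun=> 0) = 0.
Proof.
move=> [cB _]; rewrite -[RHS](subrr (c (fun=> 0))) -cB.
by congr c; apply/funext => s; rewrite subrr.
Qed.

Lemma chainD S c : is_chain S c ->
  forall f g, c (fun s => f s + g s) = c f + c g.
Proof.
move=> cc f g; have [cB _] := cc.
rewrite -[c g]opprK -[- c g]sub0r -(chain0 cc) -!cB.
by congr c; apply/funext => s; rewrite sub0r opprK.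
Qed.

Lemma chain_sub (S S' : seq Y -> Prop) c :
  (forall s, S s -> S' s) -> is_chain S c -> is_chain S' c.
Proof. by move=> SS' [cB cS]; split=> // f g fg; apply: cS => s /SS'/fg. Qed.

(** The coboundary of this cochain is the augmentation of chains in degree
    zero. *)
Definition empty_dual s : F := (nilp s)%:R.

(** [c k.+1 (coboundary f)] is the value of [f] on the boundary of [c k.+1]. No
    degree is imposed on the sequences that occur in [c k]. *)
Definition is_tower (S : seq Y -> Prop) m (c : nat -> (seq Y -> F) -> F) :=
  [/\ forall k, (k <= m)%N -> is_chain S (c k),
      forall k f, (k < m)%N -> c k.+1 (coboundary f) = c k (periodic k f) &
      c 0%N (coboundary empty_dual) = 1].

Lemma tower_sub (S S' : seq Y -> Prop) m c :
  (forall s, S s -> S' s) -> is_tower S m c -> is_tower S' m c.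
Proof. by move=> SS' [cc cr c0]; split=> // k /cc; exact: chain_sub. Qed.

Lemma base_tower y0 : exists c,
  is_tower (fun s => s = [:: y0]) 0 c /\
  forall f, c 0%N (coboundary f) = f [::].
Proof.
exists (fun _ f => f [:: y0]); split=> [|f] /=; last by rewrite subr0.
split=> //=; last by rewrite subr0.
by move=> k _; split=> // f g fg; exact: fg.
Qed.

(** The chain to be added on top of the tower is the cone, through the steps
    [h 0], .., [h n] of a contraction, on the cycle [periodic m] of [c m]. Besides
    this cycle, its boundary has two parts. The one at the end of the
    contraction is constant, hence killed by [periodic m]. The other, the cone
    on the boundary of the cycle, vanishes by [periodicK], or for m = 0 because
    [c 0] has boundary the empty sequence, which T fixes. *)
Lemma cone_tower (S S' : seq Y -> Prop) (h : nat -> Y -> Y) n m c x0 :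
  (forall s, S s -> S' s) ->
  (forall s i l t, S s -> (l < n)%N ->
     {subset t <= map (h l) (translate i s) ++ map (h l.+1) (translate i s)} ->
     S' t) ->
  (forall y, h 0%N y = y) -> (forall y, h n y = x0) ->
  is_tower S m c -> (forall f, c 0%N (coboundary f) = f [::]) ->
  exists c', is_tower S' m.+1 c' /\ forall f, c' 0%N (coboundary f) = f [::].
Proof.
move=> SS' S'h h0 hn [c_chain c_rel _] c0.
pose P f s := \sum_(l < n) prism (h l) (h l.+1) f s.
have PB f g : P (fun s => f s - g s) = fun s => P f s - P g s.
  by apply/funext => s; rewrite /P -sumrB; apply: eq_bigr => l _; rewrite prismB.
have cB f g : c m (fun s => f s - g s) = c m f - c m g.
  by have [] := c_chain m (leqnn m).
exists (fun k f => if (k <= m)%N then c k f else - c m (periodic m (P f))).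
split; last by move=> f /=; rewrite c0.
split=> [k km|k f km|]; last first.
- by rewrite /= c0.
- rewrite ltnS in km; rewrite km; case: ltnP => [|mk]; first exact: c_rel.
  have {mk km}-> : k = m by apply/eqP; rewrite eqn_leq km.
  have Pd : P (coboundary f) =
      fun s => f (map (h n) s) - f s - coboundary (P f) s.
    apply/funext => s; rewrite /P.
    rewrite (coboundary_sum _ (fun l => prism (h l) (h l.+1) f)).
    apply/eqP; rewrite eq_sym subr_eq -big_split /=.
    under eq_bigr do rewrite addrC prism_homotopy.
    rewrite -(big_mkord xpredT (fun l => f (map (h l.+1) s) - f (map (h l) s))).
    by rewrite telescope_sumr// (map_id_in (f := h 0%N)).
  have pB u v : periodic m (fun s => u s - v s) =
      fun s => periodic m u s - periodic m v s.
    by apply/funext => s; rewrite periodicB.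
  (* at the end of the contraction the cochain depends only on the length *)
  have hc s : map (h n) s = nseq (size s) x0.
    by elim: s => //= y s ->; rewrite hn.
  rewrite Pd !pB !cB (periodic_invariant _ (f := fun s => f (map (h n) s)));
    last by move=> s; rewrite !hc size_map.
  rewrite (chain0 (c_chain m (leqnn m))) periodic_coboundary.
  suff -> : c m (coboundary (periodic m (P f))) = 0 by ring.
  case: (m) c_rel c_chain => [|j] c_rel c_chain.
    by rewrite c0 /periodic /= /diffT /= subrr.
  by rewrite c_rel// periodicK (chain0 (c_chain j _)).
case: (leqP k m) => [km'|_]; first exact: chain_sub (c_chain k km').
split=> [f g|f g fg].
  have pB : periodic m (fun s => P f s - P g s) =
      fun s => periodic m (P f) s - periodic m (P g) s.
    by apply/funext => s; rewrite periodicB.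
  by rewrite PB pB cB; ring.
have [_ cS] := c_chain m (leqnn m); congr (- _); apply: cS => s Ss.
have Pfg i : P f (translate i s) = P g (translate i s).
  apply: eq_bigr => l _; apply: prism_local => t ts; apply: fg.
  exact: S'h ts.
rewrite /periodic; case: (odd m); first by apply: eq_bigr.
by rewrite /diffT -{2 4}(translate0 s) !Pfg.
Qed.

(** * Pushing a tower off the translates of a set *)

Section Slice.
Variables (S : seq Y -> Prop) (B : pred Y).
Hypothesis S_sub : forall s t, S s -> {subset t <= s} -> S t.
Hypothesis S_T : forall s, S s -> S (translate 1 s).

Definition meets s := has B s.
Hypothesis S_sep : forall s i j, S s ->
  meets (translate i s) -> meets (translate j s) -> i = j %[mod q].

Definition avoiding s := S s /\ forall i, ~~ meets (translate i s).

(** The unique exponent below [q] that moves [s] onto [B]. The reduction modulo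
    [q] sets it to zero when no translate of [s] meets [B]. *)
Definition phase s := (find (fun i => meets (translate i s)) (iota 0 q) %% q)%N.

(** Modulo the sequences that avoid all translates of [B], the chains form a
    free module over the group ring of Z/q, with basis the sequences that meet
    [B]. The operator [sweep] is the dual of a contracting homotopy of the
    complex with differentials [periodic] on this free module. *)
Definition slice_part f s : F := if meets s then f s else 0.
Definition phase_sum f s : F := - \sum_(i < phase s) f (translate i s).
Definition sweep k f := if odd k then phase_sum f else slice_part f.

Lemma S_translate i s : S s -> S (translate i s).
Proof.
elim: i => [|i IHi] Ss; first by rewrite translate0.
by rewrite -[i.+1]add1n translateD; auto.
Qed.

Lemma phase_lt s : (phase s < q)%N.
Proof. by rewrite ltn_pmod. Qed.

Lemma phaseP i s : S s -> meets (translate i s) -> phase s = (i %% q)%N.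
Proof.
move=> Ss mi; rewrite -translate_mod in mi.
have iq : (i %% q < q)%N by rewrite ltn_pmod.
have hs : has (fun i => meets (translate i s)) (iota 0 q).
  by apply/hasP; exists (i %% q)%N => //; rewrite mem_iota.
have := nth_find 0%N hs; have := hs; rewrite has_find size_iota => lt.
by rewrite nth_iota // add0n => /(S_sep Ss)/(_ mi); rewrite modn_mod.
Qed.

Lemma phase0 s : (forall i, ~~ meets (translate i s)) -> phase s = 0%N.
Proof.
move=> ns; rewrite /phase hasNfind ?size_iota ?modnn//.
by apply/hasPn => i _; exact: ns.
Qed.

Lemma meets_phase i s :
  S s -> meets (translate i s) -> meets (translate (phase s) s).
Proof. by move=> Ss mi; rewrite (phaseP Ss mi) translate_mod. Qed.

(** For the phase j of s, the sum of the g(T^i s) over i < j telescopes when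
    g = f T - f, and completes to the norm of f when T s has phase q - 1, that
    is, when j = 0. *)
Lemma sweep_homotopy k f s : S s ->
  periodic k (sweep k.+1 f) s + sweep k (periodic k.+1 f) s =
  if [exists i : 'I_q, meets (translate i s)] then f s else 0.
Proof.
move=> Ss; case: ifPn => [/existsP[i mi]|]; last first.
  rewrite negb_exists => /forallP ns.
  have {}ns i : ~~ meets (translate i s).
    by rewrite -translate_mod; apply: (ns (Ordinal (ltn_pmod i q_gt0))).
  have nt i j : ~~ meets (translate j (translate i s)) by rewrite -translateD.
  have ph i : phase (translate i s) = 0%N by apply: phase0.
  have ph' : phase s = 0%N by apply: phase0.
  have ns' : ~~ meets s by rewrite -(translate0 s).
  rewrite /periodic /sweep /=; case: (odd k) => /=.
    rewrite /normT big1 ?add0r => [|j _]; last by rewrite /slice_part (negPf (ns j)).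
    by rewrite /phase_sum ph' big_ord0 oppr0.
  by rewrite /diffT /phase_sum ph ph' !big_ord0 /slice_part (negPf ns') subrr add0r.
have {i mi}mp := meets_phase Ss mi.
have pq := phase_lt s; set j := phase s in mp pq *.
rewrite /periodic /sweep /=; case: (odd k) => /=.
  rewrite /normT (bigD1 (Ordinal pq)) //= /slice_part mp big1 ?addr0 => [|i ij];
    last first.
    case: ifP => // mi; have := S_sep Ss mi mp.
    rewrite !modn_small// => eij; case/eqP: ij; exact: val_inj.
  rewrite /phase_sum -/j /diffT sumrB opprB.
  under [X in _ + (_ - X)]eq_bigr do rewrite -translateD add1n.
  rewrite -[X in _ + (X - _)](big_mkord xpredT (fun i => f (translate i s))).
  rewrite -[X in _ + (_ - X)](big_mkord xpredT (fun i => f (translate i.+1 s))).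
  rewrite -opprB -sumrB telescope_sumr// translate0; ring.
rewrite /diffT /phase_sum /slice_part -/j.
case: (posnP j) => [j0|j_gt0].
  have ms : meets s by move: mp; rewrite j0 translate0.
  have mT : meets (translate q.-1 (translate 1 s)).
    by rewrite -translateD addn1 prednK// translate_q.
  rewrite ms (phaseP (S_T Ss) mT) j0 big_ord0 oppr0 subr0.
  rewrite modn_small ?prednK// -normT_shift.
  under eq_bigr do rewrite -translateD addn1.
  case: q q_gt0 translate_q => // r _ tq.
  by rewrite big_ord_recr /= tq; ring.
have mT : meets (translate j.-1 (translate 1 s)).
  by rewrite -translateD addn1 prednK.
rewrite (phaseP (S_T Ss) mT).
have -> : meets s = false.
  apply/negP => ms; have := @S_sep s 0 j Ss; rewrite translate0 => /(_ ms mp).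
  by rewrite mod0n modn_small// => j0; rewrite -j0 in j_gt0.
rewrite modn_small; last by rewrite (leq_ltn_trans _ pq)// leq_pred.
under eq_bigr do rewrite -translateD addn1.
rewrite addr0; case: (j) j_gt0 => // r _ /=.
by rewrite big_ord_recl translate0 /=; ring.
Qed.

(** A face of [s] that misses the translate of [B] met by [s] misses all of
    them, since [s] meets no other one. *)
Lemma avoiding_translate i t s : S s -> {subset t <= s} ->
  ~~ meets (translate (phase s) t) -> avoiding (translate i t).
Proof.
move=> Ss ts nt; have St := S_sub Ss ts; split; first exact: S_translate.
move=> j; rewrite -translateD; apply/negP => m; case/negP: nt.
have sub : {subset translate (j + i) t <= translate (j + i) s}.
  by move=> _ /mapP[y yt ->]; apply/mapP; exists y => //; exact: ts.
have ms : meets (translate (j + i) s).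
  by have /hasP[y /sub ys By] := m; apply/hasP; exists y.
by rewrite (phaseP Ss ms) translate_mod.
Qed.

(** All faces of [s] have the phase of [s], except those that avoid every
    translate of [B]. *)
Lemma sweep_coboundary k f s : S s ->
  (forall t, avoiding t -> f t = 0) ->
  coboundary (sweep k f) s = sweep k (coboundary f) s.
Proof.
move=> Ss f0; rewrite /sweep; case: (odd k); last first.
  rewrite /slice_part; case: (boolP (meets s)) => ms.
    have ph : phase s = 0%N.
      by rewrite -(translate0 s) in ms; rewrite (phaseP Ss ms) mod0n.
    apply: coboundary_local => t ts; case: ifPn => // mt.
    have := @avoiding_translate 0 t s Ss ts; rewrite ph !translate0.
    by move=> /(_ mt)/f0.
  rewrite -[RHS](coboundary0 s); apply: coboundary_local => t ts.
  case: ifP => // /hasP[y /ts ys By]; case/hasP: ms.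
  by exists y.
transitivity (coboundary (fun t => - \sum_(i < phase s) f (translate i t)) s).
  apply: coboundary_local => t ts; rewrite /phase_sum; congr (- _).
  have St := S_sub Ss ts.
  case: (boolP (meets (translate (phase s) t))) => mt.
    by rewrite (phaseP St mt) modn_small ?phase_lt.
  rewrite phase0 ?big_ord0 => [|i]; last first.
    have [_ /(_ 0%N)] := avoiding_translate i Ss ts mt.
    by rewrite translate0.
  rewrite big1 // => i _; apply: f0; exact: avoiding_translate mt.
rewrite coboundaryN (coboundary_sum _ (fun i t => f (translate i t))) /phase_sum.
by congr (- _); apply: eq_bigr => i _; rewrite coboundary_map.
Qed.

Lemma sweepB k f g s :
  sweep k (fun t => f t - g t) s = sweep k f s - sweep k g s.
Proof.
rewrite /sweep; case: (odd k); last by rewrite /slice_part; case: ifP; rewrite ?subr0.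
by rewrite /phase_sum sumrB; ring.
Qed.

Lemma sweep0 k : sweep k (fun=> 0) = fun=> 0.
Proof.
apply/funext => s; rewrite /sweep /phase_sum /slice_part.
by case: (odd k); [rewrite big1 ?oppr0|case: ifP].
Qed.

(** In the total complex of the periodic differentials and the boundary, the
    tower is a cycle and [c'] differs from it by the boundary of the [sweep] of
    the tower. Hence [c'] satisfies the same relations, with the same
    augmentation. By [sweep_homotopy] and [sweep_coboundary] what remains is
    supported on the avoiding sequences; the level above is consumed in
    [c' k]. *)
Lemma slice_tower m c : is_tower S m.+1 c -> exists c', is_tower avoiding m c'.
Proof.
move=> [c_chain c_rel c0].
pose c' k f := c k f - c k.+1 (sweep k.+1 (coboundary f))
               - c k (sweep k (periodic k.+1 f)).
have cB k : (k <= m.+1)%N -> forall f g, c k (fun s => f s - g s) = c k f - c k g.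
  by move=> /c_chain[].
exists c'; split=> [k km|k f km|]; last first.
- rewrite /c' c0 (_ : periodic 1 _ = fun=> 0); last first.
    rewrite periodic_coboundary (_ : periodic 1 _ = fun=> 0).
      by apply/funext => s; rewrite coboundary0.
    by apply: periodic_invariant => -[].
  rewrite (_ : coboundary (coboundary _) = fun=> 0); last first.
    by apply/funext => s; rewrite coboundaryK.
  by rewrite !sweep0 !(chain0 (c_chain _ _))// !subr0.
- rewrite /c' (_ : coboundary (coboundary _) = fun=> 0); last first.
    by apply/funext => s; rewrite coboundaryK.
  rewrite -[k.+2]add1n sweep0 (chain0 (c_chain _ _))// subr0.
  rewrite c_rel; last exact: leqW.
  rewrite periodicS2 (_ : periodic k.+1 (periodic k f) = fun=> 0); last first.
    by rewrite -(periodicS2 k) periodicK.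
  rewrite sweep0 (chain0 (c_chain _ _)) ?subr0; last by rewrite leqW// ltnW.
  by rewrite periodic_coboundary.
have km1 : (k <= m.+1)%N by rewrite leqW.
have c'B f g : c' k (fun s => f s - g s) = c' k f - c' k g.
  have pB : periodic k.+1 (fun s => f s - g s) =
      fun s => periodic k.+1 f s - periodic k.+1 g s.
    by apply/funext => s; rewrite periodicB.
  have dB : coboundary (fun s => f s - g s) =
      fun s => coboundary f s - coboundary g s.
    by apply/funext => s; rewrite coboundaryB.
  have sB j u v : sweep j (fun s => u s - v s) =
      fun s => sweep j u s - sweep j v s.
    by apply/funext => s; rewrite sweepB.
  by rewrite /c' pB dB !sB !cB//; ring.
split=> // f g fg; apply/eqP; rewrite -subr_eq0 -c'B; apply/eqP.
set h := fun s => f s - g s.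
have h0 t : avoiding t -> h t = 0 by move=> /fg; rewrite /h => ->; rewrite subrr.
have [_ cS] := c_chain k km1.
have [_ cS'] := c_chain k.+1 km.
(* on a cochain [h] that vanishes on [avoiding], the terms of [c' k h] cancel *)
have e1 : c k h = c k (fun s => periodic k (sweep k.+1 h) s
                                + sweep k (periodic k.+1 h) s).
  apply: cS => s Ss; rewrite sweep_homotopy//.
  case: ifPn => // /existsPn ns; apply: h0; split => // i.
  by rewrite -translate_mod; apply: (ns (Ordinal (ltn_pmod i q_gt0))).
have e2 : c k.+1 (sweep k.+1 (coboundary h)) = c k.+1 (coboundary (sweep k.+1 h)).
  by apply: cS' => s Ss; rewrite sweep_coboundary.
rewrite /c' e1 (chainD (c_chain k km1)) e2 c_rel//; ring.
Qed.

End Slice.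
End Cochains.

(** * Towers of small chains in a contractible space *)

Section ContractibleTowers.
Local Open Scope ring_scope.
Context {R : realType} {Y : topologicalType} {F : comNzRingType}.
Variables (T : Y -> Y) (q : nat) (h : Y * R -> Y) (x0 y0 : Y).
Hypothesis q_gt0 : (0 < q)%N.
Hypothesis qF : q%:R = 0 :> F.
Hypothesis Tq : forall y, iter q T y = y.
Hypothesis T_cont : continuous T.
Hypothesis h_cont : {within [set: Y] `*` `[0%R, 1%R]%classic, continuous h}.
Hypothesis h0 : forall y, h (y, 0%R) = y.
Hypothesis h1 : forall y, h (y, 1%R) = x0.

Lemma iter_cont i : continuous (iter i T).
Proof.
elim: i => [|i IHi] y /=; first exact: cvg_id.
by apply: continuous_comp; [exact: IHi|exact: T_cont].
Qed.

Lemma iter_mod i y : iter (i %% q) T y = iter i T y.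
Proof.
rewrite [in RHS](divn_eq i q) addnC iterD; congr iter.
elim: (i %/ q)%N => [//|k IHk].
by rewrite mulSn iterD -IHk Tq.
Qed.

(** Compactness of [0, 1]: on some neighborhood of [y], all sufficiently short
    time steps of the homotopy stay in one member of the cover. *)
Lemma tube (U : Y -> set Y) (y : Y) : (forall z, nbhs z (U z)) ->
  exists VM : set Y * nat, nbhs y VM.1 /\
    forall M l, (VM.2 < M)%N -> (l < M)%N -> exists z, forall v, VM.1 v ->
      U z (h (v, l%:R / M%:R)) /\ U z (h (v, l.+1%:R / M%:R)).
Proof.
move=> nU.
pose P (i : set Y * R) (s : R) := exists z, forall v s', i.1 v ->
  0 <= s' <= 1 -> `|s - s'| < i.2 -> U z (h (v, s')).
pose G := filter_prod (powerset_filter_from (nbhs y)) (0 : R)^'+.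
have GV (Q : set (set Y)) : powerset_filter_from (nbhs y) Q ->
    \forall i \near G, Q i.1.
  by move=> yQ; exists (Q, setT); [split=> //; exact: filterT|case=> ? ? []].
have Ge (Q : set R) : (0 : R)^'+ Q -> \forall i \near G, Q i.2.
  by move=> yQ; exists (setT, Q); [split=> //; exact: filterT|case=> ? ? []].
have /compact_near_coveringP/near_covering_withinP cpt : compact `[(0:R), 1]%classic.
  exact: segment_compact.
have PG : \forall i \near G, `[(0:R), 1]%classic `<=` P i.
  apply: cpt => s s01.
  have := h_cont; rewrite continuous_subspace_in => /(_ (y, s)).
  rewrite inE => /(_ (conj I s01)).
  move=> /(_ _ (nU (h (y, s)))); rewrite /= nbhs_simpl /=.
  rewrite /nbhs /= -nbhs_subspace_in//= => -[[W N] /= [yW sN] WN].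
  have [e /= e0 eN] := sN.
  have e20 : 0 < e / 2 by rewrite divr_gt0.
  have nb : nbhs (s : R) (fun s' => `|s - s'| < e / 2).
    exact: (@nbhsx_ballx R R s _ e20).
  near=> s' i => s'01; exists (h (y, s)) => v t iv t01 st.
  apply: (WN (v, t)); last by split => //=; rewrite in_itv /=.
  split=> /=; first by move: iv; apply: (near (GV _ (small_set_sub yW)) i).
  apply: eN => /=; rewrite /ball_ /=.
  have -> : s - t = (s - s') + (s' - t) by ring.
  rewrite (le_lt_trans (ler_normD _ _))// [e]splitr ltrD//.
    by rewrite (lt_le_trans st)//; apply: (near (Ge _ (nbhs_right_le e20)) i).
have {PG} : \forall i \near G, `[(0:R), 1]%classic `<=` P i /\ nbhs y i.1 /\ 0 < i.2.
  near=> i; split; first exact: (near PG i).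
  split; first by apply: (near (GV _ (near_small_set _)) i).
  by apply: (near (Ge _ (nbhs_right_gt 0)) i).
have GP : ProperFilter G by apply: filter_prod_proper.
move=> /filter_ex[[V e] /= [VP [yV e0]]].
exists (V, Num.truncn e^-1) => /=; split=> // M l eM lM.
have M0 : 0 < M%:R :> R by rewrite ltr0n (leq_ltn_trans _ lM).
have eM' : M%:R^-1 < e.
  by rewrite invf_plt ?posrE// -truncn_lt_nat// invr_ge0 ltW.
have lM01 : 0 <= (l%:R / M%:R : R) <= 1.
  by rewrite divr_ge0//= ler_pdivrMr// mul1r ler_nat ltnW.
have lM01' : 0 <= (l.+1%:R / M%:R : R) <= 1.
  by rewrite divr_ge0//= ler_pdivrMr// mul1r ler_nat.
have /VP[z zP] : `[(0 : R), 1]%classic (l%:R / M%:R) by rewrite /= in_itv.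
exists z => v Vv; split; apply: zP => //=; first by rewrite subrr normr0.
rewrite -mulrBl -natr1 opprD addrA subrr sub0r mulN1r normrN gtr0_norm ?invr_gt0//.
Unshelve. all: by end_near. Qed.

(** A compact invariant set containing all points that occur in a tower up
    to level [k], however finely the homotopy is subdivided. *)
Fixpoint reach k : set Y :=
  if k is k'.+1 then
    [set y | exists i v s,
      [/\ reach k' v, 0 <= (s : R) <= 1 & y = iter i T (h (v, s))]]
  else [set y | exists i, y = iter i T y0].

Lemma reach_iter k i y : reach k y -> reach k (iter i T y).
Proof.
case: k => [|k] /= [j]; first by move=> ->; exists (i + j)%N; rewrite iterD.
by move=> [v [s [kv s01 ->]]]; exists (i + j)%N, v, s; rewrite iterD.
Qed.

Lemma reachS k : reach k `<=` reach k.+1.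
Proof. by move=> y ky; exists 0%N, y, 0; rewrite h0 lexx ler01. Qed.

Lemma reach_compact k : compact (reach k).
Proof.
elim: k => [|k IHk].
  rewrite (_ : reach 0 = \big[setU/set0]_(i < q) [set iter i T y0]).
    by apply: bigsetU_compact => i _; exact: compact_set1.
  rewrite -(bigcup_mkord q (fun i => [set iter i T y0])).
  apply/seteqP; split=> [_ [i ->]|_ [i _ ->]].
    by exists (i %% q)%N; rewrite /= ?ltn_pmod ?iter_mod.
  by exists i.
pose H := h @` (reach k `*` `[0, 1]%classic).
have -> : reach k.+1 = \big[setU/set0]_(i < q) (iter i T @` H).
  rewrite -(bigcup_mkord q (fun i => iter i T @` H)).
  apply/seteqP; split=> [_ [i [v [s [kv s01 ->]]]]|].
    exists (i %% q)%N; first by rewrite /= ltn_pmod.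
    by exists (h (v, s)); rewrite ?iter_mod//; exists (v, s).
  by move=> _ [i _ [_ [[v s] [kv s01] <-] <-]]; exists i, v, s.
apply: bigsetU_compact => i _; apply: continuous_compact.
  by apply: continuous_subspaceT; exact: iter_cont.
apply: continuous_compact; last first.
  by apply: compact_setX => //; exact: segment_compact.
by apply: continuous_subspaceW h_cont => -[v s] [].
Qed.

(** The finite list [ys] of members of the cover is what lets the number of
    steps be chosen uniformly at the next level. *)
Definition small (U : Y -> set Y) (K : set Y) (ys : seq Y) (s : seq Y) : Prop :=
  {in s, forall w, K w} /\ exists2 y, y \in ys & {in s, forall w, U y w}.

(** By induction on [m], for all covers at once: a cover fine enough for the
    cone on the last chain of the tower to be small for [U] is supplied by
    [tube], and the shorter tower is taken small for that finer cover. *)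
Lemma contraction_tower m (U : Y -> set Y) : (forall y, nbhs y (U y)) ->
  exists ys (c : nat -> (seq Y -> F) -> F),
    is_tower T q (small U (reach m) ys) m c /\
    forall f, c 0%N (coboundary f) = f [::].
Proof.
elim: m U => [|m IHm] U nU.
  have [c [tc c0]] := base_tower F T q y0; exists [:: y0], c; split=> //.
  apply: tower_sub tc => s ->; split.
    by move=> w; rewrite inE => /eqP->; exists 0%N.
  exists y0; rewrite ?inE// => w; rewrite inE => /eqP->.
  exact: nbhs_singleton.
have [VM VMP] := choice (fun y => tube y nU).
pose V y := U y `&` [set v | forall i : 'I_q, (VM (iter i T y)).1 (iter i T v)].
have nV y : nbhs y (V y).
  apply: filterI => //; apply: filter_forall => i.
  by apply: iter_cont; have [] := VMP (iter i T y).
have [ys [c [tc c0]]] := IHm V nV.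
pose M := (\max_(y <- ys) \max_(i < q) (VM (iter i T y)).2).+1.
have VM_lt y (i : 'I_q) : y \in ys -> ((VM (iter i T y)).2 < M)%N.
  move=> yys; rewrite ltnS.
  apply: leq_trans (leq_bigmax_seq _ yys isT).
  pose G (i : 'I_q) := (VM (iter i T y)).2.
  have := @leq_bigmax _ G i; exact.
have zP (p : Y * nat * nat) : exists z : Y,
    p.1.1 \in ys -> (p.1.2 < q)%N -> (p.2 < M)%N ->
    forall v, (VM (iter p.1.2 T p.1.1)).1 v ->
      U z (h (v, p.2%:R / M%:R)) /\ U z (h (v, p.2.+1%:R / M%:R)).
  case: p => [[y i] l] /=.
  have [yys|] := boolP (y \in ys); last by exists x0.
  have [iq|] := ltnP i q; last by exists x0.
  have [lM|] := ltnP l M; last by exists x0.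
  have [_ /(_ M l (VM_lt y (Ordinal iq) yys) lM)[z zP]] := VMP (iter i T y).
  by exists z.
have [z {}zP] := choice zP.
pose zs := [seq z (p, l) | p <- [seq (y, i) | y <- ys, i <- iota 0 q], l <- iota 0 M].
exists (ys ++ zs).
apply: (cone_tower (h := fun l y => h (y, l%:R / M%:R)) (n := M) (x0 := x0)
  q_gt0 qF Tq _ _ _ _ tc c0).
- move=> s [sK [y yys sV]]; split=> [w /sK/reachS//|].
  by exists y; [rewrite mem_cat yys|move=> w /sV[]].
- move=> s i l t [sK [y yys sV]] lM ts.
  have l01 k : (k <= M)%N -> 0 <= (k%:R / M%:R : R) <= 1.
    by move=> kM; rewrite divr_ge0//= ler_pdivrMr ?ltr0n// mul1r ler_nat.
  have {}ts w : w \in t -> exists2 v, v \in s & exists2 k,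
      (k == l) || (k == l.+1) & w = h (iter i T v, k%:R / M%:R).
    move=> /ts; rewrite mem_cat /translate -!map_comp.
    by move=> /orP[] /mapP[v vs ->]; exists v => //;
      [exists l|exists l.+1]; rewrite ?eqxx ?orbT.
  split=> [w /ts[v vs [k kl ->]]|].
    exists 0%N, (iter i T v), (k%:R / M%:R); split=> //.
      by apply: reach_iter; exact: sK.
    by apply: l01; case/orP: kl => /eqP-> //; exact: ltnW.
  exists (z (y, (i %% q)%N, l)).
    rewrite mem_cat; apply/orP; right; apply/allpairsP.
    exists ((y, (i %% q)%N), l); split=> //; last by rewrite mem_iota.
    apply/allpairsP; exists (y, (i %% q)%N); split=> //.
    by rewrite mem_iota ltn_pmod.
  move=> w /ts[v vs [k kl ->]].
  have [_ /(_ (Ordinal (ltn_pmod i q_gt0)))/= Vv] := sV _ vs.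
  have := zP (y, (i %% q)%N, l) yys (ltn_pmod i q_gt0) lM _ Vv.
  by rewrite /= iter_mod; case/orP: kl => /eqP-> [].
- by move=> y; rewrite mul0r h0.
- by move=> y; rewrite divff ?h1// pnatr_eq0.
Qed.

End ContractibleTowers.

(** * Thickening a filtration in a compact space *)

Section Thickening.
Context {Z : topologicalType}.
Variables (T : Z -> Z) (q : nat).
Hypothesis Z_hausdorff : hausdorff_space Z.
Hypothesis Z_compact : compact [set: Z].
Hypothesis q_gt0 : (0 < q)%N.
Hypothesis Tq : forall y, iter q T y = y.
Hypothesis T_cont : continuous T.

Definition wandering (B : set Z) :=
  forall z i, B z -> B (iter i T z) -> (q %| i)%N.

Lemma normal_shrink (C O : set Z) : closed C -> open O -> C `<=` O ->
  exists A, [/\ open A, C `<=` A & closure A `<=` O].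
Proof.
move=> clC oO CO.
have snO : set_nbhs C O by apply/set_nbhsP; exists O; split.
have [V /set_nbhsP[A [oA CA AV]] VO] := compact_normal Z_hausdorff Z_compact clC snO.
exists A; split=> // z Az; apply: VO.
by move: z Az; apply: closureS.
Qed.

Lemma closed_preimage_iter i (C : set Z) : closed C -> closed (iter i T @^-1` C).
Proof. by move=> cC; apply: preimage_closed => // z _; exact: iter_cont. Qed.

Lemma open_avoid (C : set Z) : closed C ->
  open [set z | forall i, (0 < i < q)%N -> ~ C (iter i T z)].
Proof.
move=> cC.
rewrite (_ : mkset _ = ~` \bigcup_(i in [set i | 0 < i < q]%N) (iter i T @^-1` C)).
  rewrite openC; apply: closed_bigcup => [|i _]; last exact: closed_preimage_iter.
  by apply: sub_finite_set (finite_II q) => i /= /andP[].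
apply/seteqP; split=> z /= zC; first by move=> -[i /= /zC].
by move=> i iq Ci; apply: zC; exists i.
Qed.

(** Normality is used twice: first to find an open set whose closure misses the
    translates of [C], then to shrink its part that misses the translates of
    that closure. *)
Lemma wandering_nbhd (C : set Z) : closed C -> wandering C ->
  exists A B, [/\ open A, closed B, C `<=` A, A `<=` B & wandering B].
Proof.
move=> cC wC.
have CO : C `<=` [set z | forall i, (0 < i < q)%N -> ~ C (iter i T z)].
  move=> z Cz i /andP[i0 iq] /(wC _ _ Cz) /(dvdn_leq i0).
  by rewrite leqNgt iq.
have [A0 [oA0 CA0 A0O]] := normal_shrink cC (open_avoid cC) CO.
pose O2 := A0 `&` [set z | forall i, (0 < i < q)%N -> ~ closure A0 (iter i T z)].
have oO2 : open O2.
  apply: openI => //; apply: open_avoid; exact: closed_closure.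
have CO2 : C `<=` O2.
  move=> z Cz; split; first exact: CA0.
  move=> i /andP[i0 iq] /A0O /(_ (q - i)%N); apply.
    by rewrite subn_gt0 iq ltn_subrL i0 q_gt0.
  by rewrite -iterD subnK ?Tq// ltnW.
have [A [oA CA AO2]] := normal_shrink cC oO2 CO2.
exists A, (closure A); split=> //; first exact: closed_closure.
  exact: subset_closure.
move=> z i Az; rewrite -(iter_mod Tq) => Aiz.
rewrite /dvdn; case: (posnP (i %% q)) => [//|i0].
have [_ /(_ (i %% q)%N)] := AO2 _ Az; rewrite i0 ltn_pmod// => /(_ isT)[].
by have [/subset_closure] := AO2 _ Aiz.
Qed.

Variables (d : Z -> nat) (E : set Z).
Hypothesis d_T : forall z, d (T z) = d z.
Hypothesis E_wandering : wandering E.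
Hypothesis E_orbit : forall z, exists i, E (iter i T z).
Hypothesis E_closed :
  forall k, closed [set z | (d z < k)%N \/ (d z = k /\ E z)].

Lemma d_iter i z : d (iter i T z) = d z.
Proof. by elim: i => //= i IHi; rewrite d_T. Qed.

(** The stratum of level [n] in [E] becomes closed once the open neighborhood
    [U] of the lower strata is removed; it is then replaced by a wandering
    closed neighborhood. In this way the translates cover a neighborhood of
    each stratum, as the next step of the induction requires. *)
Lemma thickening n : exists B : nat -> set Z,
  [/\ forall k, closed (B k), forall k, wandering (B k) &
      exists U : set Z, [/\ open U, [set z | (d z < n)%N] `<=` U &
        U `<=` [set z | exists k i, (k < n)%N /\ B k (iter i T z)]]].
Proof.
elim: n => [|n [B [cB wB [U [oU dU UB]]]]].
  exists (fun=> set0); split=> [_||]; [exact: closed0|by move=> k z i []|].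
  by exists set0; split=> //; exact: open0.
pose C := [set z | (d z < n)%N \/ (d z = n /\ E z)] `\` U.
have cC : closed C by apply: closedI => //; rewrite closedC.
have CE : C `<=` E by move=> z [[/dU//|[]//]].
have wC : wandering C by move=> z i /CE Ez /CE; exact: E_wandering.
have [A [B' [oA cB' CA AB' wB']]] := wandering_nbhd cC wC.
exists (fun k => if k == n then B' else B k); split=> [k|k|]; first by case: eqP.
  by case: eqP.
exists (\bigcup_(i in [set: nat]) (iter i T @^-1` (U `|` A))); split.
- apply: bigcup_open => i _; apply: open_comp; last exact: openU.
  by move=> z _; exact: iter_cont.
- move=> z /=; rewrite ltnS leq_eqVlt => /orP[/eqP zn|zn]; last first.
    by exists 0%N => //; left; exact: dU.
  have [i Ei] := E_orbit z; exists i => //=.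
  have [?|nU] := pselect (U (iter i T z)); [by left|right].
  by apply: CA; split=> //; right; rewrite d_iter.
- move=> z [i _ [/UB[k [j [kn Bk]]]|/AB' B'z]]; last first.
    by exists n, i; rewrite eqxx ltnSn.
  exists k, (j + i)%N; rewrite iterD (ltn_eqF kn); split=> //.
  exact: ltnW.
Qed.

End Thickening.

(** * A contractible space has no free cyclic action of finite dimension *)

Section SubsetTopology.
Context {Y : topologicalType} (K : set Y).

Lemma set_type_compact : compact K -> compact [set: K].
Proof.
move=> cK G PG _.
have GK : (set_val @ G) K.
  by apply: (@filterS _ G _ setT) => [z _|]; [exact: set_valP|exact: filterT].
have [p [Kp pG]] := cK _ _ GK.
exists (exist _ p (mem_set Kp)); split=> // A B GA /= [_ [[W oW <-] /= Wp WB]].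
have GA' : (set_val @ G) (set_val @` A).
  by apply: (@filterS _ G _ A) => // z Az; exists z.
have [_ [[z Az <-] Wz]] := pG _ W GA' (open_nbhs_nbhs (conj oW Wp)).
by exists z; split=> //; exact: WB.
Qed.

Lemma set_type_hausdorff : hausdorff_space Y -> hausdorff_space K.
Proof.
move=> hY z w zw; apply: val_inj; apply: hY => A B zA wB.
have cval := @initial_continuous K Y set_val.
have [v [Av Bv]] := zw _ _ (cval z _ zA) (cval w _ wB).
by exists (set_val v).
Qed.

End SubsetTopology.

Section NoWanderingContraction.
Context {R : realType} {Y : topologicalType}.
Variables (T : Y -> Y) (q n : nat) (d : Y -> nat) (E : set Y).
Hypothesis Y_hausdorff : hausdorff_space Y.
Hypothesis q_gt1 : (1 < q)%N.
Hypothesis Tq : forall y, iter q T y = y.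
Hypothesis T_cont : continuous T.
Hypothesis d_le : forall y, (d y <= n)%N.
Hypothesis d_T : forall y, d (T y) = d y.
Hypothesis E_wandering : wandering T q E.
Hypothesis E_orbit : forall y, exists i, E (iter i T y).
Hypothesis E_closed :
  forall k, closed [set y | (d y < k)%N \/ (d y = k /\ E y)].

Let q_gt0 : (0 < q)%N := ltnW q_gt1.

(** [thickening] in the compact space [K]; compact subsets of [K] are closed in
    [Y]. *)
Lemma compact_wandering_cover (K : set Y) :
  compact K -> (forall y, K y -> K (T y)) ->
  exists B : nat -> set Y,
  [/\ forall k, closed (B k), forall k, wandering T q (B k) &
      forall y, K y -> exists k i, (k < n.+1)%N /\ B k (iter i T y)].
Proof.
move=> cK KT.
pose TK (z : K) : K := exist _ (T (set_val z)) (mem_set (KT _ (set_valP z))).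
have TK_iter i z : set_val (iter i TK z) = iter i T (set_val z).
  by elim: i => //= i IHi; rewrite -IHi.
have cval : continuous (set_val : K -> Y) by exact: initial_continuous.
have TK_cont : continuous TK.
  apply: continuous_comp_initial => z.
  by apply: (@continuous_comp _ _ _ set_val T); [exact: cval|exact: T_cont].
have TKq z : iter q TK z = z by apply: val_inj; rewrite [LHS]TK_iter Tq.
have hK := set_type_hausdorff Y_hausdorff (K := K).
have cKT := set_type_compact cK.
have wE : wandering TK q (set_val @^-1` E).
  by move=> z i /= Ez; rewrite TK_iter; exact: E_wandering.
have oE (z : K) : exists i, (set_val @^-1` E) (iter i TK z).
  by have [i Ei] := E_orbit (set_val z); exists i; rewrite /= TK_iter.
have cE k : closed [set z : K | (d (set_val z) < k)%N \/
    (d (set_val z) = k /\ (set_val @^-1` E) z)].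
  pose Ek := [set y | (d y < k)%N \/ (d y = k /\ E y)].
  suff : closed (set_val @^-1` Ek : set K) by [].
  by apply: preimage_closed => [z _|]; [exact: cval|exact: E_closed].
have dTK (z : K) : d (set_val (TK z)) = d (set_val z) by exact: d_T.
have [B [cB wB [U [_ dU UB]]]] :=
  thickening hK cKT q_gt0 TKq TK_cont dTK wE oE cE n.+1.
exists (fun k => set_val @` B k); split=> [k|k _ i [z Bz <-] [z' Bz' e]|y Ky].
- apply: compact_closed => //; apply: continuous_compact.
    exact: continuous_subspaceT.
  exact: subclosed_compact cKT _.
- apply: (wB k z) => //; suff <- : z' = iter i TK z by [].
  by apply: val_inj; rewrite [LHS]e -TK_iter.
- pose z : K := exist _ y (mem_set Ky).
  have [|k [i [kn Bi]]] := UB z; first by apply: dU => /=; rewrite ltnS.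
  by exists k, i; split=> //; exists (iter i TK z) => //; rewrite TK_iter.
Qed.

(** The cover [U] is chosen so that a small sequence meets at most one translate
    of each [B k]: the points of [U y] only meet those translates that contain
    [y]. This condition, unlike smallness, is stable under faces and under [T],
    as [slice_tower] needs. *)
Theorem wandering_not_contractible : ~ contractible R Y.
Proof.
move=> [x0 [h [h_cont h0 h1]]].
pose F : comNzRingType := 'Z_q.
have qF : (q%:R = 0 :> F)%R by rewrite pchar_Zp.
pose K := reach (R := R) T h x0 n.+1.
have KT y i : K y -> K (iter i T y) by exact: reach_iter.
have [B [cB wB KB]] : exists B : nat -> set Y,
  [/\ forall k, closed (B k), forall k, wandering T q (B k) &
      forall y, K y -> exists k i, (k < n.+1)%N /\ B k (iter i T y)].
  apply: compact_wandering_cover; last by move=> y; exact: (KT _ 1%N).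
  exact: (reach_compact q_gt0 Tq T_cont h_cont).
pose m k := meets (fun y => `[< B k y >]).
have mP k i s : reflect (exists2 w, w \in s & B k (iter i T w))
    (m k (translate T i s)).
  rewrite /m /meets /translate has_map.
  apply: (iffP hasP) => -[w ws]; first by move=> /= /asboolP; exists w.
  by move=> Bw; exists w => //=; apply/asboolP.
pose U y := [set w | forall (k : 'I_n.+1) (i : 'I_q),
  B k (iter i T w) -> B k (iter i T y)].
have nU y : nbhs y (U y).
  apply: filter_forall => k; apply: filter_forall => i.
  have [By|nBy] := pselect (B k (iter i T y)); first by apply: filterE => w.
  have oB : open (~` (iter i T @^-1` B k)).
    by rewrite openC; exact: closed_preimage_iter.
  have : nbhs y (~` (iter i T @^-1` B k)) by exact: open_nbhs_nbhs.
  by apply: filterS => w.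
have [ys [c [tc _]]] :=
  contraction_tower x0 q_gt0 qF Tq T_cont h_cont h0 h1 n.+1 nU.
pose S j s := [/\ {in s, forall w, K w},
  forall k a b, (k < n.+1)%N -> m k (translate T a s) ->
    m k (translate T b s) -> a = b %[mod q] &
  forall k i, (k < j)%N -> ~~ m k (translate T i s)].
have S0 : exists c : nat -> (seq Y -> F) -> F, is_tower T q (S 0%N) n.+1 c.
  exists c; apply: tower_sub tc => s [sK [y _ sU]]; split=> // k a b kn.
  have red i : m k (translate T i s) -> B k (iter (i %% q) T y).
    move=> /mP[w ws]; rewrite -(iter_mod Tq) => Bw.
    exact: (sU w ws (Ordinal kn) (Ordinal (ltn_pmod i q_gt0))).
  move=> /red Ba /red Bb.
  have : B k (iter (q - a %% q + b %% q) T (iter (a %% q) T y)).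
    by rewrite -iterD addnAC subnK ?iterD ?Tq// ltnW// ltn_pmod.
  move=> /(wB k _ _ Ba)/dvdnP[r re].
  have e : (r * q + a %% q = q + b %% q)%N.
    by rewrite -re addnAC subnK// ltnW// ltn_pmod.
  by have := congr1 (modn^~ q) e; rewrite /= modnMDl modnDl !modn_mod.
(* clear the translates of B 0, .., B n one after the other *)
have step j : (j <= n.+1)%N ->
    exists c : nat -> (seq Y -> F) -> F, is_tower T q (S j) (n.+1 - j) c.
  elim: j => [_|j IHj jn]; first by rewrite subn0.
  have [c' tc'] := IHj (ltnW jn); rewrite subnS in tc' *.
  have Ssub s t : S j s -> {subset t <= s} -> S j t.
    move=> [sK sep ns] ts; have mts k i : m k (translate T i t) -> m k (translate T i s).
      by move=> /mP[w /ts ws Bw]; apply/mP; exists w.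
    split=> [w /ts/sK//|k a b kn /mts ma /mts mb|k i kj].
      exact: sep ma mb.
    by apply: contra (ns k i kj); exact: mts.
  have ST s : S j s -> S j (translate T 1 s).
    move=> [sK sep ns]; split=> [_ /mapP[w /sK wK ->]|k a b kn|k i kj].
    - exact: (KT _ 1%N).
    - rewrite -!translateD => ma mb.
      by have /eqP := sep k _ _ kn ma mb; rewrite eqn_modDr => /eqP.
    - by rewrite -translateD; exact: ns.
  have Ssep s a b : S j s -> meets (fun y => `[< B j y >]) (translate T a s) ->
      meets (fun y => `[< B j y >]) (translate T b s) -> a = b %[mod q].
    by move=> [_ sep _]; exact: sep.
  have tc'' : is_tower T q (S j) (n.+1 - j).-1.+1 c'.
    by rewrite prednK// subn_gt0.
  have [c'' t''] := slice_tower q_gt0 qF Tq Ssub ST Ssep tc''.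
  exists c''; apply: tower_sub t'' => s [[sK sep ns] av]; split=> // k i.
  rewrite ltnS leq_eqVlt => /orP[/eqP->|]; [exact: av|exact: ns].
have [c' ] := step _ (leqnn n.+1); rewrite subnn => -[c'_chain _].
have [_ c'S] := c'_chain 0%N isT.
rewrite (c'S _ (fun=> 0%R)).
  by rewrite (chain0 (c'_chain 0%N isT)) => /esym/eqP; rewrite oner_eq0.
case=> // w s [sK _ nm]; have := sK w (mem_head _ _).
move=> /KB[k [i [kn Bi]]]; case/negP: (nm k i kn).
by apply/mP; exists w; rewrite ?mem_head.
Qed.
End NoWanderingContraction.

(** * Finite groups whose order is not a prime power *)

Section PrimePowerNormalizers.
Variable gT : finGroupType.
Local Open Scope group_scope.
Local Open Scope nat_scope.

(** The assumption to be refuted when the order is not a prime power. *)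
Hypothesis normalizer_pgroup : forall (p : nat) (P : {group gT}),
  p.-group P -> P :!=: 1%g -> p.-group 'N(P)%g.

Let G := [set: gT]%G.

(** For two distinct Sylow subgroups with nontrivial intersection D of maximal
    order, D is properly contained in its normalizers in both of them, since
    normalizers grow in p-groups. The normalizer of D is a p-group, hence lies
    in one Sylow subgroup, which meets both in more than D. *)
Lemma Sylow_TI p (P Q : {group gT}) : p.-Sylow(G) P -> p.-Sylow(G) Q ->
  (P :&: Q)%g != 1%g -> P :=: Q.
Proof.
have [n] := ubnP (#|G| - #|(P :&: Q)%g|); elim: n P Q => // n IHn P Q.
move=> le_n sylP sylQ ntD.
have [pP pQ] := (pHall_pgroup sylP, pHall_pgroup sylQ).
set D := (P :&: Q)%G.
have pD : p.-group D by apply: pgroupS pP; exact: finset.subsetIl.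
have [S sylS NS] := Sylow_superset (finset.subsetT _) (normalizer_pgroup pD ntD).
have grow (K : {group gT}) : p.-Sylow(G) K -> D \proper K -> S :=: K.
  move=> sylK DK; apply: IHn => //.
    have DSK : D \proper (S :&: K)%g.
      have nilK := pgroup_nil (pHall_pgroup sylK).
      apply: proper_sub_trans (nilpotent_proper_norm nilK DK) _.
      rewrite finset.subsetI finset.subsetIl andbT.
      by rewrite (fintype.subset_trans _ NS)// finset.subsetIr.
    apply: leq_trans (_ : #|G| - #|D| <= n)%N => //.
    apply: ltn_sub2l; last exact: proper_card.
    by apply: leq_trans (proper_card DSK) (subset_leq_card (finset.subsetT _)).
  apply: contraNneq ntD => e; rewrite -subG1 -e finset.subsetI.
  rewrite (proper_sub DK) andbT (fintype.subset_trans _ NS)//; exact: normG.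
have cPQ : #|P| = #|Q| by rewrite (card_Hall sylP) (card_Hall sylQ).
have [PQ|nPQ] := boolP (P \subset Q).
  by apply/eqP; rewrite eqEcard PQ cPQ leqnn.
have [QP|nQP] := boolP (Q \subset P).
  by apply/esym/eqP; rewrite eqEcard QP cPQ leqnn.
have SP : S :=: P.
  apply: grow => //; rewrite finset.properEneq finset.subsetIl andbT.
  by apply: contraNneq nPQ => <-; exact: finset.subsetIr.
have SQ : S :=: Q.
  apply: grow => //; rewrite finset.properEneq finset.subsetIr andbT.
  by apply: contraNneq nQP => <-; exact: finset.subsetIl.
by rewrite -SP.
Qed.

(** A Sylow subgroup P is its own normalizer and meets its other conjugates
    trivially, so the conjugates of P have (|P| - 1) |G : P| nontrivial
    elements, and this is at least half of |G|. *)
Lemma half_pelements p : prime p -> (p %| #|G|)%N ->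
  exists A : {set gT}, [/\ #|G| <= 2 * #|A|, 1%g \notin A &
    {in A, forall x, p.-elt x}].
Proof.
move=> p_pr pG; have [P sylP] := Sylow_exists p G.
have pP := pHall_pgroup sylP.
have ntP : P :!=: 1%g.
  rewrite -cardG_gt1 (card_Hall sylP) p_part_gt1 mem_primes p_pr cardG_gt0.
  exact: pG.
have NP : 'N(P)%g = P.
  apply/esym/eqP; rewrite finset.eqEsubset normG /=.
  have [S sylS NS] := Sylow_superset (finset.subsetT _) (normalizer_pgroup pP ntP).
  have PS : P :=: S.
    apply: (Sylow_TI sylP sylS).
    by rewrite (finset.setIidPl (fintype.subset_trans (normG P) NS)).
  by move: NS; rewrite -PS.
have TI : normedTI P^# G P.
  apply/normedTI_P; split=> [||g _].
  - by rewrite finset.setD_eq0 subG1.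
  - by rewrite finset.subsetI finset.subsetT normD1 normG.
  rewrite -finset.setI_eq0 => /finset.set0Pn[x]; rewrite !inE conjD1g !inE.
  move=> /andP[/andP[x1 xP] /andP[_ xPg]].
  suff : g \in 'N(P)%g by rewrite NP.
  apply/normP/esym; apply: (@Sylow_TI p P (P :^ g)%G) => //.
    by rewrite pHallJ ?inE.
  by apply/trivgPn; exists x; rewrite // inE xP.
exists (class_support P^# G); split.
- rewrite (card_support_normedTI TI) -(Lagrange (finset.subsetT P)).
  rewrite mulnA leq_mul2r; apply/orP; right.
  have := finset.cardsD1 1%g P; rewrite group1 /= => e.
  have : 1 < #|P| by rewrite cardG_gt1.
  by rewrite e !add1n mul2n -addnn ltnS => lt; rewrite -add1n leq_add2r.
- apply/negP => /imset2P[x g]; rewrite !inE => /andP[x1 _] _ /eqP.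
  by rewrite eq_sym conjg_eq1 (negPf x1).
- move=> _ /imset2P[x g /setD1P[_ xP] _ ->].
  by rewrite p_eltJ (mem_p_elt pP).
Qed.

(** Two distinct prime divisors would give two disjoint sets of nontrivial
    elements, each containing at least half of the group. *)
Lemma pgroup_of_normalizers : exists2 p, prime p & p.-group G.
Proof.
case: (leqP #|G| 1) => [G1|G1].
  exists 2 => //; apply: (@pgroupS _ _ 1%G); last exact: pgroup1.
  by rewrite subG1 trivg_card_le1.
have p_pr := pdiv_prime G1; exists (pdiv #|G|) => //.
apply/pgroupP => q q_pr qG; rewrite inE /=; apply/negPn/negP => qp.
have [A [cA A1 pA]] := half_pelements p_pr (pdiv_dvd _).
have [B [cB B1 qB]] := half_pelements q_pr qG.
have dAB : (A :&: B = finset.set0)%SET.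
  apply/finset.setP => x; rewrite !inE; apply/negP => /andP[xA xB].
  case/negP: A1; suff <- : x = 1%g by [].
  have px := pA x xA; have qx := qB x xB.
  apply/eqP; rewrite -order_eq1; apply/eqP.
  apply: (pnat_1 px); apply: sub_in_pnat qx => r _ /=.
  by rewrite !inE => /eqP->.
have cAB : #|(A :|: B)%SET| = (#|A| + #|B|)%N.
  by rewrite -cardsUI dAB cards0 addn0.
have : #|(A :|: B)%SET| < #|G|.
  apply: proper_card; rewrite finset.properEneq finset.subsetT andbT.
  by apply: contraNneq A1 => e; have := group1 G; rewrite -e inE (negPf B1) orbF.
rewrite cAB ltnNge => /negP[].
by rewrite -(leq_pmul2l (isT : 0 < 2)) mulnDr {1}mul2n -addnn leq_add.
Qed.
End PrimePowerNormalizers.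

Lemma not_prime_power_normalizer (gT : finGroupType) :
  ~ (exists p a : nat, prime p /\ #|gT| = (p ^ a)%N) ->
  exists p q (P : {group gT}) (x g : gT), [/\ prime p, prime q, p <> q &
    [/\ (p.-group P)%g, x \in P, #[x]%g = p, #[g]%g = q & g \in 'N(P)%g]].
Proof.
move=> npp; apply: contrapT => no; apply: npp.
have [|p p_pr] := @pgroup_of_normalizers gT.
  move=> p P pP ntP; apply/pgroupP => q q_pr qN; apply: contrapT => qp.
  have [p_pr pP' _] := pgroup_pdiv pP ntP.
  have [x xP ox] := Cauchy p_pr pP'; have [g gN og] := Cauchy q_pr qN.
  apply: no; exists p, q, P, x, g; split=> // pq; apply: qp.
  by rewrite pq inE.
by move=> /p_natP[a]; rewrite cardsT => ca; exists p, a.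
Qed.

Lemma groupClosed_of (G : groupType) (A : set G) :
  A 1%g -> (forall x y, A x -> A y -> A (x * y)%g) ->
  (forall x, A x -> A x^-1%g) ->
  exists N : groupClosed G, forall x, x \in N <-> A x.
Proof.
move=> A1 AM AV; pose N : {pred G} := fun x => `[< A x >].
have NV : invg_closed N by move=> x /asboolP Ax; exact/asboolP/AV.
have N1 : 1%g \in N by exact/asboolP.
have NM : mulg_closed N by move=> x y /asboolP Ax /asboolP Ay; exact/asboolP/AM.
pose N' : groupClosed G := HB.pack_for (groupClosed G) N
  (isInvClosed.Build G N NV) (isMul1Closed.Build G N N1) (isMulClosed.Build G N NM).
by exists N' => x; split=> [/asboolP//|Ax]; exact/asboolP.
Qed.

Lemma finGroup_of (K : groupType) : finite_group K ->
  exists (gT : finGroupType) (f : gT -> K),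
    [/\ {morph f : x y / (x * y)%g}, bijective f & [set: K] #= `I_#|gT|].
Proof.
move=> /finite_seqP[e eE].
have e_mem x : x \in undup e.
  by rewrite mem_undup; have : [set: K] x by []; rewrite eE.
have e_enum : Finite.axiom (undup e).
  by move=> x; rewrite count_uniq_mem ?undup_uniq// e_mem.
have e_pcan : pcancel (index^~ (undup e)) (onth (undup e)).
  by move=> x; rewrite onthE (nth_map x) ?index_mem// nth_index.
pose gT : finGroupType := HB.pack_for finGroupType K
  (Choice_isCountable.Build K e_pcan) (fintype.isFinite.Build K e_enum).
exists gT, id; split=> //; first by exists id.
rewrite cardE (_ : [set: K] = [set` enum gT]); first exact/card_uniq_seq/enum_uniq.
by rewrite predeqE => x; split=> // _; have : (x : gT) \in enum gT by rewrite mem_enum.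
Qed.

Lemma morph_id (gT : finGroupType) (K : groupType) (f : gT -> K) :
  {morph f : x y / (x * y)%g} -> f 1%g = 1%g.
Proof. by move=> fM; apply: (mulgI (f 1%g)); rewrite -fM !mulg1. Qed.

Lemma morph_exp (gT : finGroupType) (K : groupType) (f : gT -> K) :
  {morph f : x y / (x * y)%g} -> forall x n, f (x ^+ n)%g = (f x ^+ n)%g.
Proof.
move=> fM x; elim=> [|n IHn]; first by rewrite !expg0 morph_id.
by rewrite !expgS fM IHn.
Qed.

Lemma morph_inv (gT : finGroupType) (K : groupType) (f : gT -> K) :
  {morph f : x y / (x * y)%g} -> forall x, f x^-1%g = (f x)^-1%g.
Proof.
by move=> fM x; apply: (mulgI (f x)); rewrite -fM !mulgV morph_id.
Qed.

Lemma prime_power_group_order (K : groupType) : prime_power_group K ->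
  exists r, forall p (x : K), prime p -> (x ^+ p = 1)%g -> x <> 1%g -> p = r.
Proof.
move=> [r [a [r_pr Ka]]]; exists r => p x p_pr xp x1.
have finK : finite_group K by exists (r ^ a)%N.
have [gT [f [fM [g fK gK] cK]]] := finGroup_of finK.
have cT : #|gT| = (r ^ a)%N.
  by apply/card_eq_II; apply: card_eq_trans Ka; rewrite card_eq_sym.
have ox : #[g x]%g = p.
  apply: nt_prime_order => //; last first.
    by apply/eqP => gx1; apply: x1; rewrite -(gK x) gx1 morph_id.
  by apply: (can_inj fK); rewrite morph_exp// gK xp morph_id.
have : (p %| r ^ a)%N.
  by rewrite -cT -ox -cardsT; apply: order_dvdG; rewrite inE.
by rewrite Euclid_dvdX// => /andP[+ _]; rewrite dvdn_prime2// => /eqP.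
Qed.

Lemma not_prime_power_subgroup (G : groupType) (H : groupClosed G) :
  finite_group (subgroup H) -> ~ prime_power_group (subgroup H) ->
  exists p q (N : groupClosed G) (x g : G), [/\ prime p, prime q, p <> q &
    [/\ prime_power_group (subgroup N), x \in N, (x ^+ p = 1)%g, x <> 1%g &
    [/\ (g ^+ q = 1)%g, forall i, (g ^+ i = 1)%g -> (q %| i)%N &
      forall n, n \in N -> (n ^ g)%g \in N]]].
Proof.
move=> finH npp; have [gT [f [fM [f' fK f'K] cK]]] := finGroup_of finH.
have [|p [q [P [y [h [p_pr q_pr pq [pP yP oy oh hN]]]]]]] :=
    @not_prime_power_normalizer gT.
  by move=> [p [a [p_pr ca]]]; apply: npp; exists p, a; rewrite -ca.
pose phi u : G := val (f u).
have phiM : {morph phi : u v / (u * v)%g} by move=> u v; rewrite /phi fM.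
have phi_inj : injective phi by move=> u v /val_inj/(can_inj fK).
have [N NP] : exists N : groupClosed G,
    forall z, z \in N <-> exists2 u, u \in P & z = phi u.
  apply: groupClosed_of.
  - by exists 1%g; rewrite ?group1 ?morph_id.
  - move=> _ _ [u uP ->] [v vP ->]; exists (u * v)%g; first exact: groupM.
    by rewrite phiM.
  - move=> _ [u uP ->]; exists u^-1%g; first by rewrite groupV.
    by rewrite morph_inv.
exists p, q, N, (phi y), (phi h); split=> //; split.
- have [a ca] := p_natP pP; exists p, a; split=> //; rewrite -ca.
  have PE : (val : subgroup N -> G) @` [set: subgroup N] = phi @` [set` enum P].
    apply/seteqP; split=> [_ [[z zN] _ <-]|_ [u /= uP <-]].
      by have [u uP /= e] := (NP z).1 zN; exists u; rewrite /= ?mem_enum.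
    have uN : phi u \in N by apply/NP; exists u => //; rewrite -mem_enum.
    by exists (exist _ (phi u) uN).
  have cP : [set` enum P] #= `I_#|P| by rewrite cardE; exact/card_uniq_seq/enum_uniq.
  have cphi : phi @` [set` enum P] #= [set` enum P].
    by apply: inj_card_eq => u v _ _; exact: phi_inj.
  apply: card_eq_trans (card_eq_trans cphi cP); rewrite -PE card_eq_sym.
  by apply: inj_card_eq => u v _ _; exact: val_inj.
- by apply/NP; exists y.
- by rewrite -morph_exp// -oy expg_order morph_id.
- rewrite -(morph_id phiM) => /phi_inj y1.
  by move: p_pr; rewrite -oy y1 order1.
- split.
  + by rewrite -morph_exp// -oh expg_order morph_id.
  + move=> i; rewrite -morph_exp// -(morph_id phiM) => /phi_inj/eqP.
    by rewrite -order_dvdn oh.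
  + move=> _ /NP[u uP ->]; apply/NP; exists (u ^ h)%g; first by rewrite memJ_norm.
    by rewrite /conjg !phiM morph_inv.
Qed.

(** * Closed unions of cells *)

Section DiscTopology.
Context {R : realType} (n : nat).
Local Open Scope ring_scope.

Lemma sqnorm_continuous : continuous (fun v : 'rV[R]_n => \sum_(i < n) v ord0 i ^+ 2).
Proof.
apply: continuous_big => [|i _ v]; first exact: add_continuous.
apply: (@continuous_comp _ _ _ (fun v : 'rV[R]_n => v ord0 i) (fun r : R => r ^+ 2)).
  exact: coord_continuous.
exact: exprn_continuous.
Qed.

Lemma disc_compact : compact (@disc R n).
Proof.
pose box := [set v : 'rV[R]_n | forall i, `[(-1 : R), 1]%classic (v ord0 i)].
have box_compact : compact box.
  by apply: (@rV_compact R n (fun=> `[-1, 1]%classic)) => i; exact: segment_compact.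
apply: (subclosed_compact _ box_compact).
  rewrite (_ : disc n = (fun v : 'rV[R]_n => \sum_(i < n) v ord0 i ^+ 2) @^-1`
    [set r | r <= 1])//.
  by apply: preimage_closed => [v _|]; [exact: sqnorm_continuous|exact: closed_le].
move=> v /= v1 i /=; rewrite in_itv /= -ler_norml.
rewrite -(@expr_le1 _ 2)// real_normK ?num_real//.
apply: le_trans v1; rewrite (bigD1 i)//= lerDl.
by apply: sumr_ge0 => j _; exact: sqr_ge0.
Qed.

Lemma sphere_compact : compact (@sphere R n).
Proof.
apply: (subclosed_compact _ disc_compact); last first.
  by move=> v; rewrite /sphere /disc /= => ->.
rewrite (_ : sphere n = (fun v : 'rV[R]_n => \sum_(i < n) v ord0 i ^+ 2) @^-1`
  [set r | r = 1])//.
by apply: preimage_closed => [v _|]; [exact: sqnorm_continuous|exact: closed_eq].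
Qed.

End DiscTopology.

Section CellUnions.
Context {R : realType} {X : topologicalType} (cw : cw_structure R X).

Lemma open_cell_inj (c c' : cell cw) x :
  open_cell c x -> open_cell c' x -> c = c'.
Proof.
move=> cx c'x.
by apply: (open_cell_disjoint (c0 := cw)) => //; exists x.
Qed.

Lemma open_cell_sub (c : cell cw) : open_cell c `<=` closed_cell c.
Proof. by apply: image_subset => v; rewrite /open_disc /disc /= => /ltW. Qed.

Lemma closed_cellE (c : cell cw) :
  closed_cell c = open_cell c `|` char_map (c := c) @` sphere (Defs.dim c).
Proof.
rewrite -image_setU; congr (_ @` _); apply/seteqP; split=> v;
  rewrite /disc /sphere /open_disc /=.
  by rewrite le_eqVlt => /orP[/eqP|]; [right|left].
by move=> [/ltW|->].
Qed.

Lemma closed_cell_closed (c : cell cw) : closed (closed_cell c).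
Proof.
apply: (compact_closed (cw_hausdorff cw)).
by apply: continuous_compact; [exact: char_map_continuous|exact: disc_compact].
Qed.

Lemma boundary_closed (c : cell cw) :
  closed (char_map (c := c) @` sphere (Defs.dim c)).
Proof.
apply: (compact_closed (cw_hausdorff cw)).
apply: continuous_compact; last exact: sphere_compact.
by apply: continuous_subspaceW (@char_map_continuous _ _ _ c) => v;
  rewrite /sphere /disc /= => ->.
Qed.

(** By the weak topology it suffices to look at each closed cell, by induction
    on its dimension. A cell outside [D] meets the union only in its boundary,
    which is covered by finitely many cells of smaller dimension; a cell of [D]
    has its boundary in the cells of dimension less than [k], hence in the
    union. *)
Lemma cells_closed k (D : set (cell cw)) :
  (forall c, (Defs.dim c < k)%N -> D c) -> (forall c, D c -> (Defs.dim c <= k)%N) ->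
  closed (\bigcup_(c in D) open_cell c).
Proof.
move=> Dlow Dup; set A := \bigcup_(c in D) _.
apply: (@weak_topology _ _ cw) => c.
have [m] := ubnP (Defs.dim c); elim: m c => // m IHm c cm.
have [L [finL Ldim bdL]] := closure_finite c.
have [Dc|nDc] := pselect (D c).
  suff cA : closed_cell c `<=` A.
    by rewrite setIidr//; exact: closed_cell_closed.
  rewrite closed_cellE => x [cx|/bdL[d Ld dx]]; first by exists c.
  by exists d => //; apply: Dlow; apply: leq_trans (Ldim d Ld) (Dup c Dc).
have -> : A `&` closed_cell c = char_map (c := c) @` sphere (Defs.dim c) `&`
    \bigcup_(d in (L : set {classic cell cw})) (A `&` closed_cell (d : cell cw)).
  rewrite closed_cellE; apply/seteqP; split=> x.
    move=> [Ax [cx|bx]].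
      by case: Ax => d Dd dx; case: nDc; rewrite (open_cell_inj cx dx).
    split=> //; have [d Ld dx] := bdL _ bx; exists d => //; split=> //.
    exact: open_cell_sub.
  by move=> [bx [d _ [Ax _]]]; split=> //; right.
apply: closedI; first exact: boundary_closed.
apply: closed_bigcup => // d Ld; apply: IHm.
by rewrite (leq_trans (Ldim d Ld)).
Qed.

End CellUnions.

(** * Finite subgroups of a group with a finite-dimensional model *)

Lemma prime_power_finite (K : groupType) : prime_power_group K -> finite_group K.
Proof. by move=> [p [a [_ h]]]; exists (p ^ a)%N. Qed.

Section FixedPoints.
Context {R : realType} {G : groupType} (X : G_CW_complex R G).
Hypothesis X_model : is_model_E prime_power_groups X.

Lemma actX g i (x : X) : Defs.act (g ^+ i)%g x = iter i (Defs.act g) x.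
Proof.
elim: i => [|i IHi] /=; first by rewrite expg0 Defs.act1.
by rewrite expgS Defs.actM IHi.
Qed.

Lemma stabilizer_prime_power (y : X) : exists r,
  forall p (x : G), prime p -> (x ^+ p = 1)%g -> x <> 1%g -> Defs.act x y = y -> p = r.
Proof.
have [S SP] : exists S : groupClosed G, forall x, x \in S <-> Defs.act x y = y.
  apply: groupClosed_of; first exact: Defs.act1.
    by move=> x z xy zy; rewrite Defs.actM zy.
  by move=> x xy; rewrite -{1}xy -Defs.actM mulVg Defs.act1.
have ppS : prime_power_group (subgroup S).
  apply: contrapT => /(X_model S).2 S0.
  suff : fixed_points X S y by rewrite S0.
  by move=> g /SP.
have [r rP] := prime_power_group_order ppS; exists r => p x p_pr xp x1 /SP xS.
apply: (rP p (exist _ x xS)) => //; last by move=> /(congr1 val).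
apply: val_inj; rewrite /= -[RHS]xp.
by elim: p {xp p_pr} => // p IHp; rewrite !expgS /= IHp.
Qed.

(** The filtration of the fixed points of [N] is by the dimension of the cell
    [cl z] containing [z]. Choosing a cell in each orbit of cells under [g]
    gives the wandering set [E] of the points in chosen cells: if [z] and its
    translate by [g ^+ i] are in the same cell, then this element maps the cell
    to itself and therefore fixes [z]. *)
Theorem finite_subgroup_prime_power (H : groupClosed G) :
  finite_dimensional X -> finite_group (subgroup H) ->
  prime_power_group (subgroup H).
Proof.
move=> [n dimX] finH; apply: contrapT => /(not_prime_power_subgroup finH).
move=> [p [q [N [x [g [p_pr q_pr pq [ppN xN xp x1 [gq gord gN]]]]]]]].
pose Y := fixed_points X N.
have contrY : contractible R Y by exact: (X_model N).1.
have gY y : Y y -> Y (Defs.act g y).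
  move=> Yy m mN; rewrite -Defs.actM.
  have -> : (m * g = g * (m ^ g))%g by rewrite -conjgC.
  by rewrite Defs.actM Yy//; exact: gN.
pose T (z : Y) : Y := exist _ (Defs.act g (set_val z)) (mem_set (gY _ (set_valP z))).
have T_iter i z : set_val (iter i T z) = iter i (Defs.act g) (set_val z).
  by elim: i => //= i IHi; rewrite -IHi.
have cval : continuous (set_val : Y -> X) by exact: initial_continuous.
have T_cont : continuous T.
  apply: continuous_comp_initial => z.
  apply: (@continuous_comp _ _ _ set_val (Defs.act g)); first exact: cval.
  exact: act_continuous.
have Tq z : iter q T z = z.
  by apply: val_inj; rewrite [LHS]T_iter -actX gq Defs.act1.
have hY : hausdorff_space Y by apply: set_type_hausdorff; exact: (cw_hausdorff (cells X)).
have [cl clP] : exists cl : Y -> cell (cells X), forall z, open_cell (cl z) (set_val z).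
  suff : forall z : Y, exists c : cell (cells X), open_cell c (set_val z).
    by move=> /choice[cl clP]; exists cl.
  move=> z.
  have : [set: X] (set_val z) by [].
  by rewrite -(open_cell_cover (cells X)) => -[c _ cz]; exists c.
have cl_act z g' : forall w, set_val w = Defs.act g' (set_val z) ->
    Defs.act g' @` open_cell (cl z) = open_cell (cl w) /\
    Defs.dim (cl w) = Defs.dim (cl z).
  move=> w wz; have [c' dc' ec'] := act_cell g' (cl z).
  suff <- : c' = cl w by [].
  apply: (open_cell_inj (x := set_val w)) => //.
  by rewrite -ec' wz; exists (set_val z).
have cl_T z w : cl z = cl w -> cl (T z) = cl (T w).
  move=> e; have [ez _] := cl_act z g (T z) erefl.
  have [ew _] := cl_act w g (T w) erefl.
  apply: (open_cell_inj (x := set_val (T z))) => //.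
  by rewrite -ew -e ez.
(* the orbit of cells; it depends on the cell of [z] only *)
pose O z := [set c | exists i, c = cl (iter i T z)].
have O_cl z w : cl z = cl w -> O z = O w.
  move=> e; have ei i : cl (iter i T z) = cl (iter i T w).
    by elim: i => //= i; exact: cl_T.
  by apply/seteqP; split=> _ [i ->]; exists i; rewrite ei.
have O_iter z i : O (iter i T z) = O z.
  apply/seteqP; split=> _ [j ->]; first by exists (j + i)%N; rewrite iterD.
  have q_gt0 := prime_gt0 q_pr.
  exists (j + q.-1 * i)%N; congr cl; rewrite -iterD -addnA -mulSnr prednK//.
  by rewrite -[RHS](iter_mod Tq) addnC mulnC modnMDl (iter_mod Tq).
have [z0 _] := contrY.
have [rep repP] : exists rep : set (cell (cells X)) -> cell (cells X),
    forall S c, S c -> S (rep S).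
  suff : forall S : set (cell (cells X)), exists c', forall c, S c -> S c'.
    by move=> /choice[rep repP]; exists rep => S c; exact: repP.
  move=> S.
  have [[c Sc]|nS] := pselect (exists c, S c); first by exists c.
  by exists (cl z0) => c Sc; case: nS; exists c.
pose E := [set z : Y | cl z = rep (O z)].
apply: (@wandering_not_contractible R Y T q n (fun z => Defs.dim (cl z)) E
  _ _ _ _ _ _ _ _ _ contrY) => //.
- exact: prime_gt1.
- by move=> z; have [] := cl_act z g (T z) erefl.
- move=> z i Ez Ei.
  have wz : set_val (iter i T z) = Defs.act (g ^+ i)%g (set_val z) by rewrite T_iter actX.
  have fixz : Defs.act (g ^+ i)%g (set_val z) = set_val z.
    apply: act_stab (clP z); have [-> _] := cl_act z _ _ wz.
    by congr open_cell; rewrite [LHS]Ei O_iter -Ez.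
  have [r rP] := stabilizer_prime_power (set_val z).
  have pr : p = r by apply: (rP p x) => //; exact: (set_valP z).
  apply: contrapT => nqi; apply: pq; rewrite pr; apply/esym.
  apply: (rP q (g ^+ i)%g) => //; last by move=> /gord.
  by rewrite -expgM mulnC expgM gq expg1n.
- move=> z; have [i ei] : O z (rep (O z)) by apply: (repP _ (cl z)); exists 0%N.
  by exists i; rewrite /E /= O_iter.
- move=> k.
  pose D := [set c : cell (cells X) | (Defs.dim c < k)%N \/
    (Defs.dim c = k /\ exists2 w : Y, E w & cl w = c)].
  have : closed (\bigcup_(c in D) open_cell c).
    apply: (@cells_closed _ _ _ k) => c; first by left.
    by move=> [/ltnW//|[->]].
  have -> : [set z : Y | (Defs.dim (cl z) < k)%N \/ Defs.dim (cl z) = k /\ E z] =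
      set_val @^-1` (\bigcup_(c in D) open_cell c).
    apply/seteqP; split=> z.
      move=> zk; exists (cl z) => //; case: zk => [|[zk Ez]]; first by left.
      by right; split=> //; exists z.
    move=> [c Dc cz] /=; have <- := open_cell_inj cz (clP z).
    case: Dc => [|[ck [w Ew wc]]]; [by left|right; split=> //].
    have wz : cl w = cl z by rewrite wc; exact: open_cell_inj cz (clP z).
    by rewrite /E /= -wz -(O_cl _ _ wz).
  by apply: preimage_closed => z _; exact: cval.
Qed.

End FixedPoints.

Theorem corollary2p3 (R : realType) (G : groupType) :
  admits_fd_model_E R prime_power_groups G <->
  ((forall H : groupClosed G,
      finite_groups (subgroup H) -> prime_power_groups (subgroup H)) /\
   admits_fd_model_E R finite_groups G).
Proof.
split=> [[X [X_model X_fd]]|[fin_pp [X [X_model X_fd]]]].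
  have fin_pp (H : groupClosed G) :
      finite_groups (subgroup H) -> prime_power_groups (subgroup H).
    exact: finite_subgroup_prime_power X_fd.
  split=> //; exists X; split=> // H; have [X_contr X_empty] := X_model H.
  by split=> [/fin_pp/X_contr//|nf]; apply: X_empty => /prime_power_finite.
exists X; split=> // H; have [X_contr X_empty] := X_model H.
split=> [/prime_power_finite/X_contr//|npp].
by apply: X_empty => /fin_pp.
Qed.
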